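(* The relation $\sim$ on $X$, defined by $a\sim b$ iff $a*b^{-1}\in\mathcal{U}$, is reflexive, symmetric and transitive, so that $X$ partitions into mutually disjoint equivalence classes.
   Context: Functions on the circle $S^1$ are identified with $2\pi$-periodic functions on $\mathbb{R}$. $X$ is the complex vector space of sequences $a=(a_1,a_2,\dots)$ with $a_i\in L^\infty(S^1)$ (complex-valued) for which there is $l>0$ (depending on $a$) with $\sup_{x\in S^1}|a_i(x)|\le l^i$ for all $i\ge1$ (sup understood as the $L^\infty$-norm). For $a,b\in X$: $a*b=(a_1*b_1,a_2*b_2,\dots)\in X$ and $a^{-1}=(a_1^{-1},a_2^{-1},\dots)\in X$, where $(a_i*b_i)(t)=2a_i(2t)$ for $0<t\le\pi$, $(a_i*b_i)(t)=2b_i(2t-2\pi)$ for $\pi<t\le2\pi$, and $a_i^{-1}(t)=-a_i(2\pi-t)$ for $0<t\le2\pi$ (extended $2\pi$-periodically). Basic iterated integrals: $I_{i_1,\dots,i_k}(a)=\int\cdots\int_{0\le s_1\le\cdots\le s_k\le2\pi}a_{i_k}(s_k)\cdots a_{i_1}(s_1)\,ds_k\cdots ds_1$. The set of universal centers is $\mathcal{U}=\{a\in X: I_{i_1,\dots,i_k}(a)=0\text{ for all } k\ge1 \text{ and all positive integers } i_1,\dots,i_k\}$. *)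

(* Defs.v *)
From HB Require Import structures.
From mathcomp Require Import all_boot all_order all_algebra.
From mathcomp Require Import all_classical all_reals all_analysis.
From mathcomp Require Import measurable_realfun ess_sup_inf complex.
From mathcomp Require Import ring lra.

Set Implicit Arguments.
Unset Strict Implicit.
Unset Printing Implicit Defensive.

Import Order.TTheory GRing.Theory Num.Theory numFieldNormedType.Exports.

Local Open Scope classical_set_scope.
Local Open Scope ring_scope.
Local Open Scope quotient_scope.

Section CircleFunctions.
Context {R : realType}.
Local Notation leb := (@lebesgue_measure R).
Local Notation normc := (@Normc.normc R).
Implicit Types f g : R -> R[i].

Definition circle_itv : set R := `]0, 2 * pi]%classic.

Lemma measurable_circle_itv : measurable (circle_itv : set (measurableTypeR R)).
Proof. exact: measurable_itv. Qed.

Definition circle_measure : set (measurableTypeR R) -> \bar R :=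
  mrestr lebesgue_measure measurable_circle_itv.

HB.instance Definition _ := Measure.on circle_measure.

#[global] Instance lebesgue_ae_filter : Filter (nbhs (almost_everywhere leb)).
Proof. exact: ae_filter_ringOfSetsType. Qed.

#[global] Instance circle_ae_filter :
  Filter (nbhs (almost_everywhere circle_measure)).
Proof. exact: ae_filter_ringOfSetsType. Qed.

(* The representative of t modulo 2 pi lying in ]0, 2 pi]. *)
Definition to_circle_itv (t : R) : R :=
  t - (Num.ceil (t / (2 * pi)) - 1)%:~R * (2 * pi).

(* The 2 pi-periodic extension of the restriction of f to ]0, 2 pi]. *)
Definition periodize f (t : R) : R[i] := f (to_circle_itv t).

Definition cmeasurable f : Prop :=
  measurable_fun [set: R] (fun t => complex.Re (f t)) /\
  measurable_fun [set: R] (fun t => complex.Im (f t)).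

Definition supnorm f : \bar R :=
  'N[circle_measure]_+oo [EFin \o (normc \o f)].

Definition cat_fun f g : R -> R[i] := periodize (fun t =>
  if t <= pi then 2 * f (2 * t) else 2 * g (2 * t - 2 * pi)).

Definition inv_fun f : R -> R[i] := periodize (fun t => - f (2 * pi - t)).

Let twopi_gt0 : 0 < 2 * pi :> R.
Proof. by rewrite mulr_gt0// pi_gt0. Qed.

Lemma to_circle_itv_id t : circle_itv t -> to_circle_itv t = t.
Proof.
rewrite /circle_itv/= in_itv/= => /andP[t0 t1]; rewrite /to_circle_itv.
rewrite (@ceil_def _ _ 1) ?subrr ?mul0r ?subr0//.
by rewrite ler_pdivrMr// mul1r t1 andbT divr_gt0.
Qed.

Lemma to_circle_itv_periodic t : to_circle_itv (t + 2 * pi) = to_circle_itv t.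
Proof.
rewrite /to_circle_itv; set p := 2 * pi.
have -> : (t + p) / p = t / p + 1 by rewrite mulrDl divff// gt_eqF.
by rewrite ceilDrz// ceil1 addrK !rmorphB/=; ring.
Qed.

Lemma measurable_to_circle_itv : measurable_fun [set: R] to_circle_itv.
Proof.
apply: measurable_funB => //; apply: measurable_funM => //.
apply: nondecreasing_measurable => // x y xy; rewrite ler_int lerB//.
by rewrite ceil_le// ler_wpM2r// invr_ge0 ltW.
Qed.

Lemma cmeasurable_comp f (h : R -> R) :
  measurable_fun [set: R] h -> cmeasurable f -> cmeasurable (f \o h).
Proof.
by move=> mh [mr mi]; split; [move: mr|move: mi] => /measurableT_comp; exact.
Qed.

Lemma cmeasurable_double f :
  cmeasurable f -> cmeasurable (fun t => 2 * f t).
Proof.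
move=> [mr mi]; split.
  rewrite (_ : (fun _ => _) = (fun t => complex.Re (f t) + complex.Re (f t))).
    exact: measurable_funD.
  by apply/funext => t; rewrite mulr_natl mulr2n; case: (f t).
rewrite (_ : (fun _ => _) = (fun t => complex.Im (f t) + complex.Im (f t))).
  exact: measurable_funD.
by apply/funext => t; rewrite mulr_natl mulr2n; case: (f t).
Qed.

Lemma cmeasurable_opp f : cmeasurable f -> cmeasurable (fun t => - f t).
Proof.
move=> [mr mi]; split.
  rewrite (_ : (fun _ => _) = (fun t => - complex.Re (f t))).
    exact: measurableT_comp.
  by apply/funext => t; case: (f t).
rewrite (_ : (fun _ => _) = (fun t => - complex.Im (f t))).
  exact: measurableT_comp.
by apply/funext => t; case: (f t).
Qed.

Lemma cmeasurable_if (b : R -> bool) f g : measurable_fun [set: R] b ->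
  cmeasurable f -> cmeasurable g ->
  cmeasurable (fun t => if b t then f t else g t).
Proof.
move=> mb [fr fi] [gr gi]; split.
  rewrite (_ : (fun _ => _) =
    (fun t => if b t then complex.Re (f t) else complex.Re (g t))).
    exact: measurable_fun_ifT.
  by apply/funext => t; case: ifP.
rewrite (_ : (fun _ => _) =
  (fun t => if b t then complex.Im (f t) else complex.Im (g t))).
  exact: measurable_fun_ifT.
by apply/funext => t; case: ifP.
Qed.

Lemma measurable_affine (k c : R) : measurable_fun [set: R] (fun t => k * t + c).
Proof. by apply: measurable_funD => //; exact: measurable_funM. Qed.

Lemma cmeasurable_cat f g :
  cmeasurable f -> cmeasurable g -> cmeasurable (cat_fun f g).
Proof.
move=> mf mg; apply: (cmeasurable_comp measurable_to_circle_itv).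
apply: cmeasurable_if; first exact: measurable_fun_ler.
- apply: cmeasurable_double; apply: (@cmeasurable_comp f (fun t => 2 * t)) => //.
  exact: measurable_funM.
- apply: cmeasurable_double.
  apply: (@cmeasurable_comp g (fun t => 2 * t - 2 * pi)) => //.
  exact: measurable_affine.
Qed.

Lemma cmeasurable_inv f : cmeasurable f -> cmeasurable (inv_fun f).
Proof.
move=> mf; apply: (cmeasurable_comp measurable_to_circle_itv).
apply: cmeasurable_opp; apply: (@cmeasurable_comp f (fun t => 2 * pi - t)) => //.
exact: measurable_funB.
Qed.

Lemma ae_affine (k c : R) (P : R -> Prop) : k != 0 ->
  {ae leb, forall t, P t} -> {ae leb, forall t, P (k * t + c)}.
Proof.
move=> k0 [N [mN N0 PN]].
pose phi : measurableTypeR R -> measurableTypeR R := fun t => k * t + c.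
have mphi : measurable_fun [set: R] phi := measurable_affine k c.
exists (phi @^-1` N); split; last by move=> t nPt; exact: PN.
  by rewrite -[X in measurable X]setTI; exact: mphi.
have kn0 : 0 <= `|k| by [].
have /(_ mphi) H := @lebesgue_measure_unique R
  (mscale (NngNum kn0) (pushforward leb phi : {measure set _ -> \bar R})).
suff hyp : forall X, ocitv X -> leb X =
    mscale (NngNum kn0) (pushforward leb phi) X.
  have := H (hyp mphi) N mN; rewrite N0 /mscale/= /pushforward => /esym/eqP.
  by rewrite mule_eq0 eqe normr_eq0 (negPf k0)/= => /eqP.
move=> m _ [[a b]] _ <-/=.
rewrite /mscale/= /pushforward lebesgue_measure_itv/= lte_fin.
have [k_gt0|k_lt0|/eqP] := ltgtP 0 k; last by rewrite eq_sym (negPf k0).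
  have -> : phi @^-1` `]a, b] = `](a - c) / k, (b - c) / k]%classic.
    apply/seteqP; split=> t; rewrite /phi/= !in_itv/= ltr_pdivrMr// ler_pdivlMr//;
      by rewrite ltrBlDr lerBrDr mulrC.
  rewrite lebesgue_measure_itv/= lte_fin ltr_pM2r ?invr_gt0// ltrD2r.
  case: ifPn => ab; last by rewrite mule0.
  rewrite -!EFinB -EFinM gtr0_norm//; congr EFin; field.
  by rewrite gt_eqF.
have -> : phi @^-1` `]a, b] = `[(b - c) / k, (a - c) / k[%classic.
  apply/seteqP; split=> t; rewrite /phi/= !in_itv/= ltr_ndivlMr// ler_ndivrMr//;
    by rewrite ltrBlDr lerBrDr mulrC andbC.
rewrite lebesgue_measure_itv/= lte_fin ltr_nM2r ?invr_lt0// ltrD2r.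
case: ifPn => ab; last by rewrite mule0.
rewrite -!EFinB -EFinM ltr0_norm//; congr EFin; field.
by rewrite lt_eqF.
Qed.

Lemma ae_circleP (P : R -> Prop) :
  {ae circle_measure, forall t, P t} <-> {ae leb, forall t, circle_itv t -> P t}.
Proof.
split=> -[N [mN N0 PN]].
  exists (N `&` circle_itv); split => //.
    by apply: measurableI => //; exact: measurable_circle_itv.
  by move=> t /not_implyP[? ?]; split => //; exact: PN.
exists (N `|` ~` circle_itv); split => //.
- by apply: measurableU => //; apply: measurableC; exact: measurable_circle_itv.
- rewrite /circle_measure/= /mrestr setIUl setICl setU0.
  apply/eqP; rewrite eq_le measure_ge0 andbT -N0 le_measure ?inE//.
  by apply: measurableI => //; exact: measurable_circle_itv.
- move=> t nPt; have [tarc|] := pselect (circle_itv t); last by right.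
  by left; apply: PN => /(_ tarc).
Qed.

Lemma circle_measure_gt0 : (0 < circle_measure [set: R])%E.
Proof.
rewrite /circle_measure/= /mrestr setTI lebesgue_measure_itv/= lte_fin.
by rewrite twopi_gt0 oppr0 adde0 lte_fin.
Qed.

Lemma supnormP f (y : \bar R) :
  (supnorm f <= y)%E <-> {ae circle_measure, forall t, ((normc (f t))%:E <= y)%E}.
Proof.
rewrite /supnorm unlock circle_measure_gt0.
have nE t : `|normc (f t)| = normc (f t).
  by rewrite ger0_norm//; case: (f t) => a b; rewrite /= sqrtr_ge0.
split=> [/ess_supP|H].
  by apply: filterS => t /=; rewrite nE.
by apply/ess_supP; apply: filterS H => t /=; rewrite nE.
Qed.

Lemma ae_cat (P Q : R -> Prop) :
  {ae circle_measure, forall t, P t} -> {ae circle_measure, forall t, Q t} ->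
  {ae circle_measure, forall t,
     if t <= pi then P (2 * t) else Q (2 * t - 2 * pi)}.
Proof.
move=> /ae_circleP aeP /ae_circleP aeQ; apply/ae_circleP.
have n2 : (2 : R) != 0 by [].
have := ae_affine 0 n2 aeP; have := ae_affine (- (2 * pi)) n2 aeQ.
apply: filterS2 => t; rewrite addr0 /circle_itv/= !in_itv/= => tQ tP /andP[t0 t1].
case: ifPn => [tpi|]; first by apply: tP; rewrite mulr_gt0//= ler_pM2l.
rewrite -ltNge => pit; apply: tQ; rewrite subr_gt0 ltr_pM2l// pit/=.
by lra.
Qed.

Lemma ae_inv (P : R -> Prop) :
  {ae circle_measure, forall t, P t} ->
  {ae circle_measure, forall t, P (2 * pi - t)}.
Proof.
move=> /ae_circleP aeP; apply/ae_circleP.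
have n1 : (-1 : R) != 0 by rewrite oppr_eq0.
have ae2pi : {ae leb, forall t, t != 2 * pi}.
  exists [set 2 * pi]; split => //; first exact: lebesgue_measure_set1.
  by move=> t /= /negP/negPn/eqP.
move: (ae_affine (2 * pi) n1 aeP) ae2pi.
apply: filterS2 => t; rewrite mulN1r addrC => tP t2pi.
rewrite /circle_itv/= in_itv/= => /andP[t0 t1]; apply: tP.
rewrite /circle_itv/= in_itv/= subr_gt0 lt_neqAle t2pi t1/=.
by rewrite lerBlDr lerDl ltW.
Qed.

Lemma cat_fun_ae f f' g g' :
  {ae circle_measure, forall t, f t = f' t} ->
  {ae circle_measure, forall t, g t = g' t} ->
  {ae circle_measure, forall t, cat_fun f g t = cat_fun f' g' t}.
Proof.
move=> ff' gg'; have /ae_circleP := ae_cat ff' gg' => H.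
apply/ae_circleP; apply: filterS H => t tH ta.
rewrite /cat_fun /periodize to_circle_itv_id//; move: (tH ta).
by case: ifP => _ ->.
Qed.

Lemma inv_fun_ae f f' :
  {ae circle_measure, forall t, f t = f' t} ->
  {ae circle_measure, forall t, inv_fun f t = inv_fun f' t}.
Proof.
move=> ff'; have /ae_circleP := ae_inv ff' => H.
apply/ae_circleP; apply: filterS H => t tH ta.
by rewrite /inv_fun /periodize to_circle_itv_id// tH.
Qed.

Lemma supnorm_ae f f' :
  {ae circle_measure, forall t, f t = f' t} -> supnorm f = supnorm f'.
Proof.
move=> ff'; apply/eqP; rewrite eq_le; apply/andP; split; apply/supnormP.
  have /supnormP := lexx (supnorm f').
  by move: ff'; apply: filterS2 => t ->.
have /supnormP := lexx (supnorm f).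
by move: ff'; apply: filterS2 => t ->.
Qed.

Lemma supnorm_cat f g (M : R) :
  (supnorm f <= M%:E)%E -> (supnorm g <= M%:E)%E ->
  (supnorm (cat_fun f g) <= (2 * M)%:E)%E.
Proof.
move=> /supnormP fM /supnormP gM; apply/supnormP.
have /ae_circleP H := ae_cat fM gM.
apply/ae_circleP; apply: filterS H => t tH ta.
rewrite /cat_fun /periodize to_circle_itv_id//; move: (tH ta).
have n2 : normc 2 = 2.
  have -> : (2 : R[i]) = (2 : R)%:C%C by rewrite rmorph_nat.
  by rewrite /= expr0n addr0 sqrtr_sqr ger0_norm.
by case: ifP => _; rewrite !lee_fin Normc.normcM n2 ler_pM2l.
Qed.

Lemma supnorm_inv f (M : R) :
  (supnorm f <= M%:E)%E -> (supnorm (inv_fun f) <= M%:E)%E.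
Proof.
move=> /supnormP fM; apply/supnormP.
have /ae_circleP H := ae_inv fM.
apply/ae_circleP; apply: filterS H => t tH ta.
by rewrite /inv_fun /periodize to_circle_itv_id// normcN; exact: tH.
Qed.

Lemma periodize_periodic f t : periodize f (t + 2 * pi) = periodize f t.
Proof. by rewrite /periodize to_circle_itv_periodic. Qed.

End CircleFunctions.

(* Representatives of the elements of L^oo(S^1), which is their quotient by
   almost-everywhere equality. *)
Record bounded_periodic (R : realType) := BoundedPeriodic {
  bp_fun :> R -> R[i];
  bp_periodic : forall t, bp_fun (t + 2 * pi) = bp_fun t;
  bp_measurable : cmeasurable bp_fun;
  bp_bounded : (supnorm bp_fun < +oo)%E }.

HB.instance Definition _ (R : realType) := gen_eqMixin (bounded_periodic R).
HB.instance Definition _ (R : realType) := gen_choiceMixin (bounded_periodic R).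

Section Linf.
Context {R : realType}.
Implicit Types f g : bounded_periodic R.

Definition ae_eq_bp f g : bool :=
  `[< {ae @circle_measure R, forall t, f t = g t} >].

Let ae_eq_bp_refl : reflexive ae_eq_bp.
Proof. by move=> f; apply/asboolP; exact: nearW. Qed.

Let ae_eq_bp_sym : symmetric ae_eq_bp.
Proof.
by move=> f g; apply/idP/idP => /asboolP H; apply/asboolP; apply: filterS H.
Qed.

Let ae_eq_bp_trans : transitive ae_eq_bp.
Proof.
move=> g f h /asboolP fg /asboolP gh; apply/asboolP; move: fg gh.
by apply: filterS2 => t ->.
Qed.

Canonical ae_eq_bp_equiv :=
  EquivRel ae_eq_bp ae_eq_bp_refl ae_eq_bp_sym ae_eq_bp_trans.

Definition Linf : Type := {eq_quot ae_eq_bp}.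
HB.instance Definition _ := Choice.on Linf.
HB.instance Definition _ := EqQuotient.on Linf.

Definition Linf_fun (f : Linf) : R -> R[i] := repr f.
Coercion Linf_fun : Linf >-> Funclass.

Lemma Linf_piP f g :
  {ae @circle_measure R, forall t, f t = g t} <-> \pi_Linf f = \pi_Linf g.
Proof. by split=> [H|/eqmodP/asboolP//]; apply/eqmodP/asboolP. Qed.

Lemma Linf_reprE f :
  {ae @circle_measure R, forall t, (\pi_Linf f : Linf) t = f t}.
Proof. by apply/Linf_piP; rewrite reprK. Qed.

Lemma supnorm_fin f : exists2 M : R, 0 <= M & (supnorm f <= M%:E)%E.
Proof.
have := bp_bounded f; case E: (supnorm f) => [r| |] // _.
  by exists (Num.max r 0); rewrite ?lee_fin le_max lexx// orbT.
by exists 0 => //; rewrite leNye.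
Qed.

Lemma bounded_cat f g : (supnorm (cat_fun f g) < +oo)%E.
Proof.
have [M M0 fM] := supnorm_fin f; have [N N0 gN] := supnorm_fin g.
apply: (@le_lt_trans _ _ (2 * Num.max M N)%:E); last exact: ltry.
by apply: supnorm_cat; [apply: (le_trans fM)|apply: (le_trans gN)];
  rewrite lee_fin le_max lexx ?orbT.
Qed.

Lemma bounded_inv f : (supnorm (inv_fun f) < +oo)%E.
Proof.
have [M M0 fM] := supnorm_fin f.
exact: le_lt_trans (supnorm_inv fM) (ltry _).
Qed.

Definition bp_cat f g : bounded_periodic R :=
  BoundedPeriodic (periodize_periodic _)
    (cmeasurable_cat (bp_measurable f) (bp_measurable g)) (bounded_cat f g).

Definition bp_inv f : bounded_periodic R :=
  BoundedPeriodic (periodize_periodic _)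
    (cmeasurable_inv (bp_measurable f)) (bounded_inv f).

Definition Linf_cat (f g : Linf) : Linf := \pi_Linf (bp_cat (repr f) (repr g)).
Definition Linf_inv (f : Linf) : Linf := \pi_Linf (bp_inv (repr f)).

Lemma Linf_cat_pi f g :
  Linf_cat (\pi_Linf f) (\pi_Linf g) = \pi_Linf (bp_cat f g).
Proof. by apply/Linf_piP; apply: cat_fun_ae; exact: Linf_reprE. Qed.

Lemma Linf_inv_pi f : Linf_inv (\pi_Linf f) = \pi_Linf (bp_inv f).
Proof. by apply/Linf_piP; apply: inv_fun_ae; exact: Linf_reprE. Qed.

End Linf.
Arguments Linf R : clear implicits.

(* The sequence a_1, a_2, ... is indexed from 0: xseq a i is a_(i+1). *)
Record Xspace (R : realType) := MkXspace {
  xseq :> nat -> Linf R;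
  xseq_bounded : exists2 l : R, 0 < l &
    forall i : nat, (supnorm (xseq i) <= (l ^+ i.+1)%:E)%E }.

Section UniversalCenters.
Context {R : realType}.
Implicit Types a b : Xspace R.

Lemma catX_bounded a b : exists2 l : R, 0 < l &
  forall i : nat, (supnorm (Linf_cat (a i) (b i)) <= (l ^+ i.+1)%:E)%E.
Proof.
have [k k0 ak] := xseq_bounded a; have [l l0 bl] := xseq_bounded b.
exists (2 * Num.max k l) => [|i]; first by rewrite mulr_gt0// lt_max k0.
rewrite (supnorm_ae (Linf_reprE _)).
have m0 : 0 <= Num.max k l by rewrite le_max ltW.
have lek : k <= Num.max k l by rewrite le_max lexx.
have lel : l <= Num.max k l by rewrite le_max lexx orbT.
have H : (supnorm (cat_fun (a i) (b i)) <= (2 * Num.max k l ^+ i.+1)%:E)%E.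
  apply: supnorm_cat; [apply: (le_trans (ak i))|apply: (le_trans (bl i))];
    by rewrite lee_fin lerXn2r// nnegrE ltW.
apply: (le_trans H); rewrite lee_fin exprMn ler_wpM2r ?exprn_ge0//.
by rewrite exprS ler_peMr// exprn_ege1// ler1n.
Qed.

Lemma invX_bounded a : exists2 l : R, 0 < l &
  forall i : nat, (supnorm (Linf_inv (a i)) <= (l ^+ i.+1)%:E)%E.
Proof.
have [l l0 al] := xseq_bounded a; exists l => // i.
by rewrite (supnorm_ae (Linf_reprE _)); apply: supnorm_inv; exact: al.
Qed.

Definition catX a b : Xspace R := MkXspace (catX_bounded a b).
Definition invX a : Xspace R := MkXspace (invX_bounded a).

Definition Cintegral (D : set R) (f : R -> R[i]) : R[i] :=
  Complex (\int[lebesgue_measure]_(u in D) complex.Re (f u))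
          (\int[lebesgue_measure]_(u in D) complex.Im (f u)).

(* Integral of a_(i_k)(s_k) ... a_(i_1)(s_1) over s <= s_1 <= ... <= s_k <= 2 pi,
   integrating in s_k first and in s_1 last. *)
Fixpoint iterated_integral_from a (w : seq nat) (s : R) : R[i] :=
  if w is i :: w' then
    Cintegral `[s, 2 * pi]%classic
      (fun u => iterated_integral_from a w' u * a i u)
  else 1.

Definition iterated_integral a (w : seq nat) : R[i] :=
  iterated_integral_from a w 0.

(* A nonempty word over nat ranges over all (i_1, ..., i_k) with k >= 1, each
   positive index being shifted by one as in xseq. *)
Definition universal_centers : set (Xspace R) :=
  [set a | forall w : seq nat, w != [::] -> iterated_integral a w = 0].

Definition sim a b : Prop := universal_centers (catX a (invX b)).

Definition sim_class a : set (Xspace R) := [set b | sim a b].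

End UniversalCenters.

(* Main.v *)
Require Import Defs.
From mathcomp Require Import all_boot all_order all_algebra.
From mathcomp Require Import all_classical all_reals all_analysis.
From mathcomp Require Import measurable_realfun complex.
From mathcomp Require Import ring lra.

(* Let [E_a w] be the iterated integral of [a] along the word [w].  Chen's
   identity says that [E_(a * b)] is the product of [E_a] and [E_b] as formal
   series in noncommuting variables.  Since [E_(b * b^-1) = 1] and every [E_b]
   has constant term 1, [a * b^-1] is a universal center iff [E_a = E_b], which
   is an equivalence relation.

   Both facts about [E] follow from a uniqueness principle: the tails
   [F_w t] of the iterated integrals over [[t, 2 pi]] solve
   [dF_(i :: w) = - F_w d(alpha_i)], where [alpha_i] is a primitive of [a_i], and
   they are determined by this equation and their value at one point.  For Chen's
   identity one compares two solutions on [[pi, 2 pi]], then on [[0, pi]].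
   For [b * b^-1] the driver [alpha] is invariant under [t |-> 2 pi - t], so
   [t |-> F_w t] and [t |-> F_w (2 pi - t)] solve the same equation on [[0, pi]]
   and agree at [pi]; hence [F_w 0 = F_w (2 pi)]. *)

Set Implicit Arguments.
Unset Strict Implicit.
Unset Printing Implicit Defensive.

Import Order.TTheory GRing.Theory Num.Theory numFieldNormedType.Exports.

Local Open Scope classical_set_scope.
Local Open Scope ring_scope.

(** * Uniqueness for equations with quadratic error, and products of noncommutative series *)

Section QuadraticallySmall.
Context {R : realType}.
Local Notation C := R[i].
Local Notation normc := (@Normc.normc R).
Implicit Types (x y s t : R) (D : R -> R -> C).

Lemma normc_ge0 (z : C) : 0 <= normc z.
Proof. by case: z => a b; rewrite /= sqrtr_ge0. Qed.

Lemma normcB_sym (z z' : C) : normc (z - z') = normc (z' - z).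
Proof. by rewrite -normcN opprB. Qed.

Definition quad x y D := exists2 K : R, 0 <= K & forall s t,
  x <= s <= y -> x <= t <= y -> normc (D s t) <= K * (t - s) ^+ 2.

Lemma eq_quad x y D D' :
  (forall s t, x <= s <= y -> x <= t <= y -> D s t = D' s t) ->
  quad x y D -> quad x y D'.
Proof.
by move=> DD' [K K0 DK]; exists K => // s t sxy txy; rewrite -DD'//; exact: DK.
Qed.

Lemma quad0 x y : quad x y (fun _ _ => 0).
Proof. by exists 0 => // s t _ _; rewrite Normc.normc0 mul0r. Qed.

Lemma quadD x y D D' :
  quad x y D -> quad x y D' -> quad x y (fun s t => D s t + D' s t).
Proof.
move=> [K K0 DK] [K' K'0 DK']; exists (K + K'); first exact: addr_ge0.
move=> s t sxy txy; apply: le_trans (le_normcD _ _) _.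
by rewrite mulrDl lerD// ?DK ?DK'.
Qed.

Lemma quadMr x y D (c : C) : quad x y D -> quad x y (fun s t => D s t * c).
Proof.
move=> [K K0 DK]; exists (K * normc c); first by rewrite mulr_ge0// normc_ge0.
move=> s t sxy txy; rewrite Normc.normcM mulrAC.
by apply: ler_wpM2r; rewrite ?normc_ge0 ?DK.
Qed.

Lemma quadB x y D D' :
  quad x y D -> quad x y D' -> quad x y (fun s t => D s t - D' s t).
Proof.
move=> qD /(quadMr (-1)) qD'; apply: eq_quad (quadD qD qD') => s t _ _.
by rewrite mulrN1.
Qed.

Lemma quad_sum x y (n : nat) (D : 'I_n -> R -> R -> C) :
  (forall i, quad x y (D i)) -> quad x y (fun s t => \sum_(i < n) D i s t).
Proof.
elim: n D => [|n IHn] D qD.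
  by apply: eq_quad (quad0 x y) => s t _ _; rewrite big_ord0.
apply: eq_quad (quadD (IHn _ (fun i => qD (widen_ord (leqnSn n) i))) (qD ord_max)).
by move=> s t _ _; rewrite big_ord_recr.
Qed.

(** The slope enters only through its square, so [k] may be negative; reflections use [k = -1]. *)
Lemma quad_affine x y x' y' (k c : R) D :
  (forall s, x <= s <= y -> x' <= k * s + c <= y') ->
  quad x' y' D -> quad x y (fun s t => D (k * s + c) (k * t + c)).
Proof.
move=> H [K K0 DK]; exists (K * k ^+ 2); first by rewrite mulr_ge0// sqr_ge0.
move=> s t /H sxy /H txy; apply: le_trans (DK _ _ sxy txy) _.
by rewrite -mulrA -exprMn; have -> : k * t + c - (k * s + c) = k * (t - s) by ring.
Qed.

(** Cutting the segment from [s] to [t] into [n] equal steps, each step changes [f] by at most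
    [K (t - s)^2 / n^2], so the total change is at most [K (t - s)^2 / n] for every [n]. *)
Lemma quad_increment_eq x y (f : R -> C) : quad x y (fun s t => f t - f s) ->
  forall s t, x <= s <= y -> x <= t <= y -> f s = f t.
Proof.
move=> [K K0 fK] s t sxy txy.
suff : normc (f t - f s) = 0.
  by move=> /Normc.eq0_normc/eqP; rewrite subr_eq0 => /eqP.
apply/eqP; rewrite eq_le normc_ge0 andbT leNgt; apply/negP => e0.
have [n n0 nK] : exists2 n : nat, 0 < n%:R :> R &
    K * (t - s) ^+ 2 < n%:R * normc (f t - f s).
  (* The Archimedean bound makes [K (t - s)^2 / n] smaller than the supposed nonzero increment; the
     successor keeps [n] positive. *)
  exists (Num.bound (K * (t - s) ^+ 2 / normc (f t - f s))).+1.
    by rewrite ltr0n.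
  rewrite -ltr_pdivrMr//; apply: lt_trans (archi_boundP _) _.
    apply: divr_ge0; last exact: normc_ge0.
    by apply: mulr_ge0; rewrite ?sqr_ge0.
  by rewrite ltr_nat.
pose d := (t - s) / n%:R.
have inxy k : (k <= n)%N -> x <= s + k%:R * d <= y.
  move=> kn; set l := k%:R / n%:R : R.
  have l0 : 0 <= l by rewrite divr_ge0.
  have l1 : l <= 1 by rewrite ler_pdivrMr// mul1r ler_nat.
  (* The subdivision points are convex combinations of [s] and [t], whichever of the two is
     larger. *)
  have -> : s + k%:R * d = (1 - l) * s + l * t by rewrite /d /l; ring.
  by move: sxy txy => /andP[? ?] /andP[? ?]; apply/andP; split; nra.
have step k : (k <= n)%N ->
    normc (f (s + k%:R * d) - f s) <= k%:R * (K * d ^+ 2).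
  elim: k => [|k IHk] kn.
    by rewrite mul0r addr0 subrr Normc.normc0 mul0r.
  rewrite -(subrKA (f (s + k%:R * d))).
  apply: le_trans (le_normcD _ _) _.
  have -> : k.+1%:R * (K * d ^+ 2) = K * d ^+ 2 + k%:R * (K * d ^+ 2).
    by rewrite -(natr1 k); ring.
  apply: lerD; last exact/IHk/ltnW.
  have := fK _ _ (inxy k (ltnW kn)) (inxy _ kn).
  suff -> : s + k.+1%:R * d - (s + k%:R * d) = d by [].
  by rewrite -(natr1 k); ring.
have := step n (leqnn n).
have -> : s + n%:R * d = t by rewrite /d mulrC divfK ?gt_eqF// addrC subrK.
rewrite leNgt => /negP; apply.
have -> : n%:R * (K * d ^+ 2) = K * (t - s) ^+ 2 / n%:R.
  by rewrite /d; field; rewrite gt_eqF.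
by rewrite ltr_pdivrMr// [_ * n%:R]mulrC.
Qed.

(* [F] consists of iterated integrals against d[alpha], up to the choice of the
   base point: [dF_(i :: w) = - F_w d(alpha_i)].  Neither the driver nor [F] is
   assumed differentiable, so the equation is a first-order expansion with
   quadratic error, which still characterises [F]. *)
Definition develops x y (alpha : nat -> R -> C) (F : seq nat -> R -> C) :=
  (forall t, F [::] t = 1) /\
  forall i w, quad x y (fun s t =>
    F (i :: w) t - F (i :: w) s + F w s * (alpha i t - alpha i s)).

Lemma develops_driver x y alpha alpha' F :
  (forall i s t, x <= s <= y -> x <= t <= y ->
     alpha i t - alpha i s = alpha' i t - alpha' i s) ->
  develops x y alpha F -> develops x y alpha' F.
Proof.
move=> aa' [F0 dF]; split => // i w; apply: eq_quad (dF i w) => s t sxy txy.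
by rewrite (aa' i s t).
Qed.

Lemma develops_affine x y x' y' (k c : R) alpha F :
  (forall s, x <= s <= y -> x' <= k * s + c <= y') ->
  develops x' y' alpha F ->
  develops x y (fun i t => alpha i (k * t + c)) (fun w t => F w (k * t + c)).
Proof.
move=> H [F0 dF]; split => // i w; exact: (quad_affine H (dF i w)).
Qed.

(** Induction on the word: once the solutions agree on [w], the driver terms cancel in the
    difference of the expansions for [i :: w], so that difference has quadratically small
    increments. It is therefore constant, and it vanishes at [z]. *)
Lemma develops_unique x y alpha F F' z : x <= z <= y ->
  develops x y alpha F -> develops x y alpha F' ->
  (forall w, F w z = F' w z) ->
  forall w t, x <= t <= y -> F w t = F' w t.
Proof.
move=> zxy [F0 dF] [F'0 dF'] FF'; elim=> [|i w IHw] t txy.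
  by rewrite F0 F'0.
have q : quad x y (fun s t =>
    (F (i :: w) t - F' (i :: w) t) - (F (i :: w) s - F' (i :: w) s)).
  apply: eq_quad (quadB (dF i w) (dF' i w)) => s u sxy _.
  by rewrite IHw//; ring.
have := quad_increment_eq q zxy txy; rewrite FF' subrr => /esym/eqP.
by rewrite subr_eq0 => /eqP.
Qed.

(** The coefficient of [w] in the product of the formal series in noncommuting variables with
    coefficients [A] and [B]. *)
Definition word_conv (A B : seq nat -> C) (w : seq nat) : C :=
  \sum_(k < (size w).+1) A (take k w) * B (drop k w).

(** The equation strips the first letter of a word, so it survives multiplication on the right by a
    series constant in [t]. *)
Lemma develops_word_conv x y alpha F (B : seq nat -> C) : B [::] = 1 ->
  develops x y alpha F ->
  develops x y alpha (fun w t => word_conv (F ^~ t) B w).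
Proof.
move=> B1 [F0 dF]; split=> [t|i w].
  by rewrite /word_conv big_ord1/= F0 B1 mulr1.
have q := quad_sum (fun k : 'I_(size w).+1 =>
  quadMr (B (drop k w)) (dF i (take k w))).
apply: eq_quad q => s t _ _; rewrite /word_conv/=.
(* The splitting of [i :: w] with empty prefix contributes [B (i :: w)], constant in [t], and
   cancels; every other prefix is [i :: take k w]. *)
rewrite !(big_ord_recl (size w).+1)/= !F0 opprD addrACA subrr add0r mulr_suml.
rewrite -sumrB -big_split/=.
by apply: eq_bigr => k _; rewrite /bump/= add0n; ring.
Qed.

(** A series with constant term 1 can be cancelled: by induction on length all terms with a proper
    prefix agree, which leaves [A w * B [::]]. *)
Lemma word_conv_injl (A A' B : seq nat -> C) : B [::] = 1 ->
  (forall w, word_conv A B w = word_conv A' B w) -> forall w, A w = A' w.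
Proof.
move=> B1 AA' w; have [n] := ubnP (size w); elim: n w => // n IHn w wn.
have := AA' w; rewrite /word_conv !big_ord_recr/= take_size drop_size B1 !mulr1.
rewrite (eq_bigr (fun k : 'I_(size w) => A' (take k w) * B (drop k w))).
  by move=> /addrI.
move=> k _; rewrite IHn// size_take ltn_ord.
exact: leq_trans (ltn_ord k) _.
Qed.

End QuadraticallySmall.

(** * Tail integrals of bounded real functions supported in []0, 2 * pi[] *)

Section RealTails.
Context {R : realType}.
Local Notation leb := (@lebesgue_measure R).
Local Notation RT := (measurableTypeR R).
Implicit Types f : R -> R.

Lemma lebesgue_itv_lty (a b : R) (ba bb : bool) :
  (leb [set` Interval (BSide ba a) (BSide bb b)] < +oo)%E.
Proof.
rewrite lebesgue_measure_itv/=; case: ifPn => _; last exact: ltry.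
by rewrite -EFinB ltry.
Qed.

(* Every class in L^oo of the circle has a representative of this kind; such
   functions are bounded and supported everywhere, not just almost everywhere. *)
Definition rtame f := [/\ measurable_fun [set: R] f,
  exists M : R, forall t, `|f t| <= M &
  forall t : R, ~~ (0 < t < 2 * pi) -> f t = 0].

Lemma rtame_integrable f (D : set RT) : measurable D -> rtame f ->
  leb.-integrable D (EFin \o f).
Proof.
move=> mD [mf [M fM] f0]; apply: (@integrableS _ _ _ leb setT) => //.
pose I : set R := `]0, 2 * pi[%classic.
have mI : measurable (I : set (measurableTypeR R)) by exact: measurable_itv.
(* Restricting to the support, of finite measure, reduces integrability on any domain to
   boundedness. *)
have -> : EFin \o f = (EFin \o f) \_ I.
  apply/funext => t; rewrite patchE; case: ifPn => //.
  by rewrite notin_setE /I/= in_itv/= => /negP/f0 ->.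
apply: (integrable_mkcond _ mI).1; apply: measurable_bounded_integrable => //.
- exact: lebesgue_itv_lty.
- exact: measurable_funTS.
- exists M; split; first exact: num_real.
  by move=> x Mx t _; apply: le_trans (fM t) _; exact: ltW.
Qed.

(** Integrating up to infinity gives the same value as up to [2 * pi] on the functions of interest,
    and lets affine substitutions act on the lower bound alone. *)
Definition rtail f (t : R) : R := \int[leb]_(u in `[t, +oo[) f u.

Lemma rtail_split f s t : rtame f -> s <= t ->
  rtail f s - rtail f t = \int[leb]_(u in `[s, t[) f u.
Proof.
move=> tf st; rewrite /rtail.
have -> : `[s, +oo[%classic = `[s, t[%classic `|` `[t, +oo[%classic.
  by apply: itv_bndbnd_setU; rewrite ?bnd_simp.
rewrite Rintegral_setU//; first by rewrite addrK.
- by apply: rtame_integrable => //; exact: measurableU.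
- apply/disj_setPS => y [/=]; rewrite !in_itv/= => /andP[_ yt].
  by rewrite andbT leNgt yt.
Qed.

Lemma rtail_lipschitz f s t K : rtame f -> s <= t ->
  (forall u, s <= u <= t -> `|f u| <= K) ->
  `|rtail f s - rtail f t| <= K * (t - s).
Proof.
move=> tf st fK; rewrite rtail_split//.
have mst : measurable (`[s, t[%classic : set RT) by exact: measurable_itv.
apply: le_trans (le_normr_Rintegral mst (rtame_integrable mst tf)) _.
have -> : K * (t - s) = \int[leb]_(u in `[s, t[) K.
  rewrite Rintegral_cst//; congr (_ * _).
  have /= -> := @lebesgue_measure_itv R `[s, t[.
  rewrite lte_fin; case: ltP => [//|ts].
  by apply/eqP; rewrite subr_eq0 eq_le ts st.
apply: le_Rintegral => //.
- exact: (integrable_norm (rtame_integrable mst tf)).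
- apply: measurable_bounded_integrable => //; last exact: bounded_cst.
  exact: lebesgue_itv_lty.
- by move=> u; rewrite /= in_itv/= => /andP[su ut]; apply: fK; rewrite su ltW.
Qed.

Lemma rtail_lipschitzT f : rtame f -> exists2 K : R, 0 <= K &
  forall s t, `|rtail f t - rtail f s| <= K * `|t - s|.
Proof.
move=> tf; have [_ [M fM] _] := tf; exists M.
  exact: le_trans (normr_ge0 _) (fM 0).
move=> s t; have [st|/ltW ts] := leP s t.
  by rewrite distrC (@ger0_norm _ (t - s)) ?subr_ge0//; apply: rtail_lipschitz.
rewrite (distrC t) (@ger0_norm _ (s - t)) ?subr_ge0//.
exact: rtail_lipschitz.
Qed.

Lemma measurable_rtail f : rtame f -> measurable_fun [set: R] (rtail f).
Proof.
move=> /rtail_lipschitzT[K K0 fK]; apply: continuous_measurable_fun => x.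
apply/cvgrPdist_le => e e0.
(* The constant [K + 1] replaces [K] to allow division when [K = 0]. *)
have d0 : 0 < e / (K + 1) by rewrite divr_gt0// ltr_wpDl.
near=> y; apply: le_trans (fK _ _) _.
apply: (@le_trans _ _ ((K + 1) * `|x - y|)).
  by rewrite ler_wpM2r// lerDl.
rewrite -ler_pdivlMl ?ltr_wpDl// mulrC.
near: y; apply: cvgr_dist_le => //; exact: cvg_id.
Unshelve. all: by end_near. Qed.

Lemma rtail_bounded f : rtame f -> exists M : R, forall t, `|rtail f t| <= M.
Proof.
move=> tf; exists (\int[leb]_u `|f u|) => t.
have mt : measurable (`[t, +oo[%classic : set RT) by exact: measurable_itv.
apply: le_trans (le_normr_Rintegral mt (rtame_integrable mt tf)) _.
rewrite [X in X <= _](@Rintegral_mkcond _ _ _ leb).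
have tT := integrable_norm (rtame_integrable measurableT tf).
apply: le_Rintegral => //.
  have := integrable_norm (rtame_integrable mt tf).
  move/(integrable_mkcond _ mt).1; apply: eq_integrable => // u _.
  by rewrite /= restrict_EFin.
by move=> u _; rewrite patchE; case: ifP => _ /=; last exact: normr_ge0.
Qed.

Lemma rtail_ge2pi f t : rtame f -> 2 * pi <= t -> rtail f t = 0.
Proof.
move=> [_ _ f0] pit; rewrite /rtail.
rewrite (@eq_Rintegral _ _ _ leb _ (cst 0)); first by rewrite Rintegral_cst// mul0r.
move=> u; rewrite inE/= in_itv/= andbT => tu; apply: f0.
by rewrite negb_and -!leNgt (le_trans pit tu) orbT.
Qed.

Lemma rtail_le0 f t : rtame f -> t <= 0 -> rtail f t = rtail f 0.
Proof.
(* The Lipschitz constant 0 is valid because [f] vanishes on [[t, 0]]. *)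
move=> tf t0; have := rtail_lipschitz tf t0 (K := 0).
rewrite mul0r normr_le0 subr_eq0 => H; apply/eqP/H => u /andP[_ u0].
have [_ _ ->] := tf; first by rewrite normr0.
by rewrite negb_and -leNgt u0.
Qed.

Lemma rtailD f g t : rtame f -> rtame g ->
  rtail (fun u => f u + g u) t = rtail f t + rtail g t.
Proof. by move=> tf tg; rewrite /rtail RintegralD//; exact: rtame_integrable. Qed.

Lemma rtailZ f k t : rtame f -> rtail (fun u => k * f u) t = k * rtail f t.
Proof. by move=> tf; rewrite /rtail RintegralZl//; exact: rtame_integrable. Qed.

Lemma rtameD f g : rtame f -> rtame g -> rtame (fun u => f u + g u).
Proof.
move=> [mf [M fM] f0] [mg [N gN] g0]; split.
- exact: measurable_funD.
- by exists (M + N) => t; apply: le_trans (ler_normD _ _) _; exact: lerD.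
- by move=> t H; rewrite f0// g0// addr0.
Qed.

Lemma rtameM (b f : R -> R) : measurable_fun [set: R] b ->
  (exists M : R, forall t, `|b t| <= M) -> rtame f -> rtame (fun u => b u * f u).
Proof.
move=> mb [N bN] [mf [M fM] f0]; split.
- exact: measurable_funM.
- by exists (N * M) => t; rewrite normrM ler_pM.
- by move=> t H; rewrite f0// mulr0.
Qed.

Lemma rtameZ (k : R) f : rtame f -> rtame (fun u => k * f u).
Proof. by apply: rtameM => //; exists `|k|. Qed.

End RealTails.

(** * Affine changes of variable in tail integrals *)

Section Substitution.
Context {R : realType}.
Local Notation leb := (@lebesgue_measure R).
Local Notation RT := (measurableTypeR R).
Implicit Types f : R -> R.

(** By uniqueness of Lebesgue measure it suffices to compare with [k] times the pushforward on
    half-open intervals. *)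
Lemma lebesgue_measure_affine (k c : R) (A : set RT) : 0 < k -> measurable A ->
  leb A = (k%:E * leb ((fun t => (k * t + c)%R) @^-1` A))%E.
Proof.
move=> k0 mA; pose phi : RT -> RT := fun t => k * t + c.
have mphi : measurable_fun [set: R] phi := measurable_affine k c.
have kn0 : 0 <= k by exact: ltW.
have /(_ mphi) H := @lebesgue_measure_unique R
  (mscale (NngNum kn0) (pushforward leb phi : {measure set _ -> \bar R})).
suff hyp : forall X, ocitv X -> leb X =
    mscale (NngNum kn0) (pushforward leb phi) X by exact: (H (hyp mphi)).
move=> m _ [[a b]] _ <-/=.
rewrite /mscale/= /pushforward lebesgue_measure_itv/= lte_fin.
have -> : phi @^-1` `]a, b] = `](a - c) / k, (b - c) / k]%classic.
  apply/seteqP; split=> t; rewrite /phi/= !in_itv/= ltr_pdivrMr// ler_pdivlMr//;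
    by rewrite ltrBlDr lerBrDr mulrC.
rewrite lebesgue_measure_itv/= lte_fin ltr_pM2r ?invr_gt0// ltrD2r.
case: ifPn => ab; last by rewrite mule0.
by rewrite -!EFinB -EFinM; congr EFin; field; rewrite gt_eqF.
Qed.

Lemma lebesgue_measure_reflect (c : R) (A : set RT) : measurable A ->
  leb A = leb ((fun t => c - t) @^-1` A).
Proof.
move=> mA; have mphi : measurable_fun [set: RT] (fun t : RT => 1 * t + c : RT).
  exact: measurable_affine.
rewrite (lebesgue_measure_affine c ltr01 mA) mul1e -lebesgue_measureN; last first.
  by rewrite -[X in measurable X]setTI; exact: mphi.
congr (leb _); apply/funext => t; rewrite /preimage/=.
by rewrite mul1r addrC.
Qed.

(** For nonnegative functions this is integration against a scaled pushforward measure; the general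
    case splits [f] into positive and negative parts. *)
Lemma Rintegral_substitution (k : R) (phi : RT -> RT) f (D : set RT) :
  measurable_fun [set: RT] phi -> 0 < k ->
  (forall A : set RT, measurable A -> leb A = (k%:E * leb (phi @^-1` A))%E) ->
  measurable D -> rtame f ->
  \int[leb]_(u in D) f u = k * \int[leb]_(u in phi @^-1` D) f (phi u).
Proof.
move=> mphi k0 lebE mD tf; have kn0 : 0 <= k by exact: ltW.
have intf := rtame_integrable mD tf.
have mf : measurable_fun [set: RT] (EFin \o f).
  by case: tf => mf _ _; exact/measurable_EFinP.
pose m := mscale (NngNum kn0) (pushforward leb phi : {measure set _ -> \bar R})
  : {measure set RT -> \bar R}.
have part (g : RT -> \bar R) :
    measurable_fun [set: RT] g -> (forall x, 0 <= g x)%E ->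
    (\int[leb]_(x in D) g x = k%:E * \int[leb]_(x in phi @^-1` D) g (phi x))%E.
  move=> mg g0; rewrite (eq_measure_integral (m mphi)); last first.
    by move=> A mA _; exact: lebE.
  rewrite ge0_integral_mscale//; last exact: measurable_funTS.
  by rewrite ge0_integral_pushforward//; exact: measurable_funTS.
have Ep : (\int[leb]_(x in D) (EFin \o f)^\+ x =
    k%:E * \int[leb]_(x in phi @^-1` D) ((EFin \o f) \o phi)^\+ x)%E.
  rewrite (funepos_comp (EFin \o f) phi).
  by apply: (part _ (measurable_funepos mf)).
have En : (\int[leb]_(x in D) (EFin \o f)^\- x =
    k%:E * \int[leb]_(x in phi @^-1` D) ((EFin \o f) \o phi)^\- x)%E.
  rewrite (funeneg_comp (EFin \o f) phi).
  by apply: (part _ (measurable_funeneg mf)).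
have ip := integrable_fin_num mD (integrable_funepos mD intf).
have im := integrable_fin_num mD (integrable_funeneg mD intf).
rewrite /Rintegral integralE [X in _ = k * fine X]integralE.
(* [fine] sends infinite values to 0, so both parts must be seen to be finite before [k] passes
   through it. *)
have kN (X A : \bar R) : X \is a fin_num -> X = (k%:E * A)%E ->
    A = (k^-1 * fine X)%:E.
  case: A => [a| |] Xfin XE; move: Xfin; rewrite XE.
  - by rewrite /= mulKf// gt_eqF.
  - by rewrite gt0_muley.
  - by rewrite gt0_muleNy.
rewrite -[X in fine (X - _)%E](fineK ip) -[X in fine (_ - X)%E](fineK im).
set P := (X in k * fine (X - _)%E); set N := (X in k * fine (_ - X)%E).
have -> : P = _ := kN _ _ ip Ep; have -> : N = _ := kN _ _ im En.
by rewrite -!EFinB/= -mulrBr mulVKf// gt_eqF.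
Qed.

Lemma rtail_affine (k c t : R) f : 0 < k -> rtame f ->
  k * rtail (fun u => f (k * u + c)) t = rtail f (k * t + c).
Proof.
move=> k0 tf; rewrite /rtail.
rewrite [RHS](@Rintegral_substitution k (fun u => k * u + c))//; last 2 first.
- exact: measurable_affine.
- by move=> A; exact: lebesgue_measure_affine.
suff -> : (fun u => k * u + c) @^-1` `[k * t + c, +oo[ = `[t, +oo[%classic by [].
by apply/seteqP; split=> u; rewrite /= !in_itv/= !andbT lerD2r ler_pM2l.
Qed.

Lemma rtail_reflect (c t : R) f : rtame f ->
  rtail (fun u => f (c - u)) t = \int[leb]_u f u - rtail f (c - t).
Proof.
move=> tf.
have m1 : measurable (`]-oo, c - t[%classic : set RT) by exact: measurable_itv.
have m2 : measurable (`[c - t, +oo[%classic : set RT) by exact: measurable_itv.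
have -> : \int[leb]_u f u = \int[leb]_(u in `]-oo, c - t[) f u + rtail f (c - t).
  have -> : [set: RT] = `]-oo, c - t[%classic `|` `[c - t, +oo[%classic.
    by rewrite -itv_bndbnd_setU ?bnd_simp// set_itvNyy.
  rewrite Rintegral_setU//.
    by apply: rtame_integrable => //; exact: measurableU.
  apply/disj_setPS => y [/=]; rewrite !in_itv/= => yt.
  by rewrite andbT leNgt yt.
(* The preimage of the closed ray []-oo, c - t]] under the reflection is [[t, +oo[], so the endpoint
   is added first. *)
rewrite addrK Rintegral_itv_bndo_bndc; last exact: rtame_integrable.
rewrite (@Rintegral_substitution 1 (fun u => c - u))//; last 2 first.
- exact: measurable_funB.
- by move=> A mA; rewrite mul1e; exact: lebesgue_measure_reflect.
rewrite mul1r /rtail; congr (Rintegral _ _ _).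
by apply/seteqP; split=> u; rewrite /= !in_itv/= ?andbT; lra.
Qed.

End Substitution.

(** * Complex tails and iterated tails *)

Section ComplexTails.
Context {R : realType}.
Local Notation normc := (@Normc.normc R).
Local Notation Re := (@complex.Re R).
Local Notation Im := (@complex.Im R).
Implicit Types f g b : R -> R[i].

Lemma complex_ext (z z' : R[i]) : Re z = Re z' -> Im z = Im z' -> z = z'.
Proof. by case: z z' => [? ?] [? ?] /= -> ->. Qed.

Lemma complexReB (z z' : R[i]) : Re (z - z') = Re z - Re z'.
Proof. by case: z z' => [? ?] []. Qed.

Lemma complexImB (z z' : R[i]) : Im (z - z') = Im z - Im z'.
Proof. by case: z z' => [? ?] []. Qed.

Lemma complexReM (z z' : R[i]) : Re (z * z') = Re z * Re z' - Im z * Im z'.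
Proof. by case: z z' => [? ?] []. Qed.

Lemma complexImM (z z' : R[i]) : Im (z * z') = Re z * Im z' + Im z * Re z'.
Proof. by case: z z' => [? ?] []. Qed.

Lemma le_Re_normc (z : R[i]) : `|Re z| <= normc z.
Proof. by case: z => a b; rewrite /= -sqrtr_sqr ler_wsqrtr// lerDl sqr_ge0. Qed.

Lemma le_Im_normc (z : R[i]) : `|Im z| <= normc z.
Proof. by case: z => a b; rewrite /= -sqrtr_sqr ler_wsqrtr// lerDr sqr_ge0. Qed.

Lemma normc_le_ReIm (z : R[i]) : normc z <= `|Re z| + `|Im z|.
Proof.
case: z => a b /=; rewrite -[leRHS]ger0_norm ?addr_ge0// -sqrtr_sqr.
rewrite ler_wsqrtr// sqrrD !real_normK ?num_real// lerD2r lerDl.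
by rewrite mulrn_wge0// mulr_ge0.
Qed.

Definition tame f := rtame (Re \o f) /\ rtame (Im \o f).

Lemma tame_out f t : tame f -> ~~ (0 < t < 2 * pi) -> f t = 0.
Proof.
move=> [[_ _ r0] [_ _ i0]] tI.
by apply: complex_ext; [exact: r0|exact: i0].
Qed.

Lemma tame_bounded f : tame f ->
  exists2 M : R, 0 <= M & forall t, normc (f t) <= M.
Proof.
move=> [[_ [M rM] _] [_ [N iN] _]]; exists (M + N).
  by rewrite addr_ge0// ?(le_trans _ (rM 0))// (le_trans _ (iN 0)).
move=> t; apply: le_trans (normc_le_ReIm _) _.
by apply: lerD; [exact: rM|exact: iN].
Qed.

(** Iterated tails belong to this class rather than to [tame]: the one for the empty word is the
    constant 1. *)
Definition bounded_measurable b := cmeasurable b /\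
  exists M : R, forall t, `|Re (b t)| <= M /\ `|Im (b t)| <= M.

Definition tail f t := Cintegral `[t, +oo[%classic f.

Lemma tailE f t : tail f t = Complex (rtail (Re \o f) t) (rtail (Im \o f) t).
Proof. by []. Qed.

Lemma tameM b f : bounded_measurable b -> tame f -> tame (fun u => b u * f u).
Proof.
move=> [[mr mi] [M bM]] [tr ti].
have br : exists M : R, forall t, `|Re (b t)| <= M by exists M => t; case: (bM t).
have bi : exists M : R, forall t, `|Im (b t)| <= M by exists M => t; case: (bM t).
split.
- have -> : Re \o (fun u => b u * f u) = fun u => Re (b u) * (Re \o f) u +
      (- 1) * (Im (b u) * (Im \o f) u).
    by apply/funext => u; rewrite /= complexReM mulN1r.
  by apply: rtameD; [exact: rtameM|apply: rtameZ; exact: rtameM].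
- have -> : Im \o (fun u => b u * f u) = fun u => Re (b u) * (Im \o f) u +
      Im (b u) * (Re \o f) u.
    by apply/funext => u; rewrite /= complexImM.
  by apply: rtameD; exact: rtameM.
Qed.

Lemma bounded_measurable_cst (c : R[i]) : bounded_measurable (cst c).
Proof.
split; first by split; exact: measurable_cst.
by exists (normc c) => t; rewrite le_Re_normc le_Im_normc.
Qed.

Lemma bounded_measurableB b (c : R[i]) : bounded_measurable b ->
  bounded_measurable (fun t => b t - c).
Proof.
move=> [[mr mi] [M bM]]; split.
  split.
  - have -> : (fun t => Re (b t - c)) = (fun t => Re (b t) - Re c).
      by apply/funext => t; rewrite complexReB.
    by apply: measurable_funB.
  - have -> : (fun t => Im (b t - c)) = (fun t => Im (b t) - Im c).
      by apply/funext => t; rewrite complexImB.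
    by apply: measurable_funB.
exists (M + normc c) => t; have [rM iM] := bM t; rewrite complexReB complexImB.
by split; (apply: le_trans (ler_normB _ _) _);
  rewrite lerD// ?le_Re_normc ?le_Im_normc.
Qed.

Lemma tail_bounded_measurable f : tame f -> bounded_measurable (tail f).
Proof.
move=> [tr ti]; split; first by split; exact: measurable_rtail.
have [M rM] := rtail_bounded tr; have [N iN] := rtail_bounded ti.
exists (Num.max M N) => t; split; rewrite le_max.
  by rewrite (rM t).
by rewrite (iN t) orbT.
Qed.

Lemma tail_lipschitz f : tame f -> exists2 K : R, 0 <= K &
  forall s t, normc (tail f t - tail f s) <= K * `|t - s|.
Proof.
move=> [/rtail_lipschitzT[K K0 rK] /rtail_lipschitzT[L L0 iL]].
exists (K + L); first exact: addr_ge0.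
move=> s t; apply: le_trans (normc_le_ReIm _) _.
by rewrite mulrDl complexReB complexImB; apply: lerD; [exact: rK|exact: iL].
Qed.

(** The factor 2 comes from bounding real and imaginary parts separately. *)
Lemma tail_increment f s t K : tame f -> s <= t ->
  (forall u, s <= u <= t -> normc (f u) <= K) ->
  normc (tail f s - tail f t) <= 2 * K * (t - s).
Proof.
move=> [tr ti] st fK; apply: le_trans (normc_le_ReIm _) _.
have -> : 2 * K * (t - s) = K * (t - s) + K * (t - s) by ring.
rewrite complexReB complexImB; apply: lerD; apply: rtail_lipschitz => // u /fK.
  exact: le_trans (le_Re_normc _).
exact: le_trans (le_Im_normc _).
Qed.

Lemma tail_ge2pi f t : tame f -> 2 * pi <= t -> tail f t = 0.
Proof. by move=> [tr ti] pit; apply: complex_ext; exact: rtail_ge2pi. Qed.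

Lemma tail_le0 f t : tame f -> t <= 0 -> tail f t = tail f 0.
Proof. by move=> [tr ti] t0; apply: complex_ext; exact: rtail_le0. Qed.

Lemma tailD f g t : tame f -> tame g ->
  tail (fun u => f u + g u) t = tail f t + tail g t.
Proof.
move=> [fr fi] [gr gi]; apply: complex_ext.
- apply: etrans (rtailD _ fr gr).
  by congr (rtail _ _); apply/funext => u /=; case: (f u) (g u) => [? ?] [].
- apply: etrans (rtailD _ fi gi).
  by congr (rtail _ _); apply/funext => u /=; case: (f u) (g u) => [? ?] [].
Qed.

Lemma tailZ f (c : R[i]) t : tame f -> tail (fun u => c * f u) t = c * tail f t.
Proof.
move=> [fr fi]; apply: complex_ext; rewrite !tailE /= ?complexReM ?complexImM/=.
- rewrite -mulNr -!rtailZ// -rtailD//; try exact: rtameZ.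
  by congr (rtail _ _); apply/funext => u; rewrite /= complexReM mulNr.
- rewrite -!rtailZ// -rtailD//; try exact: rtameZ.
  by congr (rtail _ _); apply/funext => u; rewrite /= complexImM.
Qed.

Lemma tameZ f (c : R[i]) : tame f -> tame (fun u => c * f u).
Proof. exact: tameM (bounded_measurable_cst c). Qed.

Lemma tameD f g : tame f -> tame g -> tame (fun u => f u + g u).
Proof.
move=> [fr fi] [gr gi]; split.
- have -> : Re \o (fun u => f u + g u) = fun u => (Re \o f) u + (Re \o g) u.
    by apply/funext => u /=; case: (f u) (g u) => [? ?] [].
  exact: rtameD.
- have -> : Im \o (fun u => f u + g u) = fun u => (Im \o f) u + (Im \o g) u.
    by apply/funext => u /=; case: (f u) (g u) => [? ?] [].
  exact: rtameD.
Qed.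

Lemma tail_affine (k c t : R) f : 0 < k -> tame f ->
  k%:C%C * tail (fun u => f (k * u + c)) t = tail f (k * t + c).
Proof.
move=> k0 [tr ti]; apply: complex_ext;
  rewrite ?complexReM ?complexImM /= !mul0r ?subr0 ?addr0.
- exact: (rtail_affine _ _ k0 tr).
- exact: (rtail_affine _ _ k0 ti).
Qed.

Lemma tail_reflect (c t : R) f : tame f ->
  tail (fun u => f (c - u)) t = Cintegral setT f - tail f (c - t).
Proof.
move=> [tr ti]; apply: complex_ext; rewrite ?complexReB ?complexImB.
- exact: (rtail_reflect _ _ tr).
- exact: (rtail_reflect _ _ ti).
Qed.

Fixpoint iterated_tail (g : nat -> R -> R[i]) (w : seq nat) (s : R) : R[i] :=
  if w is i :: w' then tail (fun u => iterated_tail g w' u * g i u) s else 1.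

Section IteratedTails.
Variable g : nat -> R -> R[i].
Hypothesis tg : forall i, tame (g i).

Lemma iterated_tail_bounded_measurable w : bounded_measurable (iterated_tail g w).
Proof.
elim: w => [|i w IHw]; first exact: bounded_measurable_cst.
by apply: tail_bounded_measurable; exact: tameM.
Qed.

Lemma iterated_tail_tame i w : tame (fun u => iterated_tail g w u * g i u).
Proof. by apply: tameM => //; exact: iterated_tail_bounded_measurable. Qed.

Lemma iterated_tail_lipschitz w : exists2 K : R, 0 <= K & forall s t,
  normc (iterated_tail g w t - iterated_tail g w s) <= K * `|t - s|.
Proof.
case: w => [|i w]; last exact/tail_lipschitz/iterated_tail_tame.
by exists 0 => // s t; rewrite subrr Normc.normc0 mul0r.
Qed.

(** The error term is the increment of the tail of [h u = (F_w u - F_w s) * g i u]. Between [s] and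
    [t] the first factor is at most [L |t - s|] and the second at most [M]; integrating over length
    [|t - s|] gives the square. *)
Lemma iterated_tail_develops x y :
  develops x y (fun i t => - tail (g i) t) (iterated_tail g).
Proof.
split=> // i w; have [L L0 wL] := iterated_tail_lipschitz w.
have [M M0 gM] := tame_bounded (tg i).
exists (2 * (L * M)); first by rewrite !mulr_ge0.
move=> s t _ _.
pose h u := (iterated_tail g w u - iterated_tail g w s) * g i u.
have th : tame h.
  apply: tameM => //; apply: bounded_measurableB.
  exact: iterated_tail_bounded_measurable.
have -> : iterated_tail g (i :: w) t - iterated_tail g (i :: w) s +
    iterated_tail g w s * (- tail (g i) t - - tail (g i) s) = tail h t - tail h s.
  have hE r : tail h r = iterated_tail g (i :: w) r
      + (- iterated_tail g w s) * tail (g i) r.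
    rewrite -tailZ// -tailD//; [|exact: iterated_tail_tame|exact: tameZ].
    by congr (Cintegral _ _); apply/funext => u; rewrite /h mulNr -mulrBl.
  by rewrite !hE; ring.
have hL u v d : `|u - s| <= d -> normc (h u) <= L * d * M.
  move=> sd; rewrite Normc.normcM ler_pM ?normc_ge0//.
  by apply: le_trans (wL _ _) _; rewrite ler_wpM2l.
have [st|/ltW ts] := leP s t.
- have -> : 2 * (L * M) * (t - s) ^+ 2 = 2 * (L * (t - s) * M) * (t - s) by ring.
  rewrite normcB_sym; apply: tail_increment => // u /andP[su ut]; apply: hL => //.
  by rewrite ger0_norm ?subr_ge0// lerB.
- have -> : 2 * (L * M) * (t - s) ^+ 2 = 2 * (L * (s - t) * M) * (s - t) by ring.
  apply: tail_increment => // u /andP[su ut]; apply: hL => //.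
  by rewrite distrC ger0_norm ?subr_ge0// lerB.
Qed.

Lemma iterated_tail_ge2pi w t : 2 * pi <= t ->
  iterated_tail g w t = (w == [::])%:R.
Proof.
by case: w => [|i w] //= pit; apply: tail_ge2pi => //; exact: iterated_tail_tame.
Qed.

End IteratedTails.

End ComplexTails.

(** * Chen's identity for concatenations *)

Section Concatenation.
Context {R : realType}.
Local Notation pi := (@trigo.pi R).
Implicit Types f g : R -> R[i].

(* The two summands have disjoint supports, which makes the case distinction of
   [cat_fun] superfluous. *)
Definition tame_cat f g (u : R) : R[i] :=
  2 * f (2 * u + 0) + 2 * g (2 * u + - (2 * pi)).

Definition tame_inv f (u : R) : R[i] := - f (2 * pi - u).

Lemma tame_comp f (phi : R -> R) : measurable_fun [set: R] phi ->
  (forall t, 0 < phi t < 2 * pi -> 0 < t < 2 * pi) -> tame f -> tame (f \o phi).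
Proof.
move=> mphi phiI; suff H (h : R -> R) : rtame h -> rtame (h \o phi).
  by move=> [tr ti]; split; [exact: H tr|exact: H ti].
move=> [mh [M hM] h0]; split.
- exact: (measurableT_comp mh mphi).
- by exists M => t; exact: hM.
- by move=> t tI; apply: h0; apply: contra tI; exact: phiI.
Qed.

Lemma tame_double f : tame f -> tame (fun u => f (2 * u + 0)).
Proof.
apply: (@tame_comp f (fun u => 2 * u + 0)) => [|t]; first exact: measurable_affine.
by have := pi_gt0 R; rewrite addr0; move=> p0 /andP[t0 t1]; apply/andP; split; lra.
Qed.

Lemma tame_double_shift f : tame f -> tame (fun u => f (2 * u + - (2 * pi))).
Proof.
apply: (@tame_comp f (fun u => 2 * u + - (2 * pi))) => [|t].
  exact: measurable_affine.
by have := pi_gt0 R; move=> p0 /andP[t0 t1]; apply/andP; split; lra.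
Qed.

Lemma tame_tame_cat f g : tame f -> tame g -> tame (tame_cat f g).
Proof.
move=> tf tg; apply: tameD; apply: tameZ; first exact: tame_double.
exact: tame_double_shift.
Qed.

Lemma tame_reflect f : tame f -> tame (fun u => f (2 * pi - u)).
Proof.
apply: (@tame_comp f (fun u => 2 * pi - u)) => [|t]; first exact: measurable_funB.
by move=> /andP[t0 t1]; apply/andP; split; lra.
Qed.

Lemma tame_invE f : tame_inv f = fun u => -1 * f (2 * pi - u).
Proof. by apply/funext => u; rewrite mulN1r. Qed.

Lemma tame_tame_inv f : tame f -> tame (tame_inv f).
Proof. by move=> tf; rewrite tame_invE; apply/tameZ/tame_reflect. Qed.

Lemma tail_cat f g t : tame f -> tame g ->
  tail (tame_cat f g) t = tail f (2 * t) + tail g (2 * t - 2 * pi).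
Proof.
move=> tf tg; have t1 := tame_double tf; have t2 := tame_double_shift tg.
rewrite tailD; [|exact: tameZ|exact: tameZ].
rewrite !tailZ//; have -> : (2 : R[i]) = (2 : R)%:C%C by rewrite rmorph_nat.
by rewrite !tail_affine// addr0.
Qed.

Lemma tail_inv f t : tame f ->
  tail (tame_inv f) t = tail f (2 * pi - t) - Cintegral setT f.
Proof.
move=> tf; rewrite tame_invE tailZ; last exact: tame_reflect.
by rewrite tail_reflect// mulN1r opprB.
Qed.

Variables g h : nat -> R -> R[i].
Hypotheses (tg : forall i, tame (g i)) (th : forall i, tame (h i)).

Let gh i := tame_cat (g i) (h i).
Let tgh i : tame (gh i) := tame_tame_cat (tg i) (th i).

(** On [[pi, 2 * pi]] the part of the driver coming from [g] is zero, so the concatenation develops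
    like [h] at double speed; the two solutions are compared at [2 * pi]. *)
Lemma iterated_tail_cat_pi w : iterated_tail gh w pi = iterated_tail h w 0.
Proof.
have p0 := pi_gt0 R.
have piI : pi <= pi <= 2 * pi by apply/andP; split; lra.
have p2I : pi <= 2 * pi <= 2 * pi by apply/andP; split; lra.
(* The point 0 is written as the image of [pi] under the reparametrisation of the second half. *)
have -> : 0 = 2 * pi + - (2 * pi) :> R by ring.
have hdev : develops pi (2 * pi) (fun i t => - tail (gh i) t)
    (fun w t => iterated_tail h w (2 * t + - (2 * pi))).
  apply: (@develops_driver _ _ _ (fun i t => - tail (h i) (2 * t + - (2 * pi)))).
    move=> i s t /andP[sp _] /andP[tp _].
    by rewrite !tail_cat// !(tail_ge2pi (tg i)) ?add0r// ler_pM2l.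
  apply: (develops_affine (k := 2) (c := - (2 * pi))
    _ (iterated_tail_develops th 0 (2 * pi))).
  by move=> s /andP[s0 s1]; apply/andP; split; lra.
apply: (develops_unique p2I (iterated_tail_develops tgh _ _) hdev) => // v.
by rewrite !iterated_tail_ge2pi//; lra.
Qed.

(** On [[0, pi]] the part of the driver coming from [h] is constant, so the series of [g] at double
    speed, times the full series of [h], solves the same equation; the two solutions are compared at
    [pi]. *)
Lemma iterated_tail_cat w :
  iterated_tail gh w 0 = word_conv (iterated_tail g ^~ 0) (iterated_tail h ^~ 0) w.
Proof.
have p0 := pi_gt0 R.
have zI : (0 : R) <= 0 <= pi by apply/andP; split; lra.
have pI : (0 : R) <= pi <= pi by apply/andP; split; lra.
have gdev : develops 0 pi (fun i t => - tail (gh i) t)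
    (fun w t => word_conv ((fun v t => iterated_tail g v (2 * t + 0)) ^~ t)
                     (iterated_tail h ^~ 0) w).
  apply: develops_word_conv => //.
  apply: (@develops_driver _ _ _ (fun i t => - tail (g i) (2 * t + 0))).
    move=> i s t /andP[_ sp] /andP[_ tp]; rewrite !tail_cat// !addr0.
    rewrite (tail_le0 (th i) (t := 2 * t - _)); last by lra.
    by rewrite (tail_le0 (th i) (t := 2 * s - _)); [ring|lra].
  apply: (develops_affine (k := 2) (c := 0)
    _ (iterated_tail_develops tg 0 (2 * pi))).
  by move=> s /andP[s0 s1]; apply/andP; split; lra.
have E := develops_unique pI (iterated_tail_develops tgh _ _) gdev.
rewrite E//; first by rewrite mulr0 addr0.
(* At [pi] the series of [g] is evaluated at [2 * pi], where it is 1, so only the empty prefix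
   contributes. *)
move=> v; rewrite iterated_tail_cat_pi /word_conv big_ord_recl take0 drop0 mul1r.
rewrite big1 ?addr0// => k _; rewrite iterated_tail_ge2pi ?addr0//.
have -> : (take (lift ord0 k) v == [::]) = false by case: v k => [[]|].
by rewrite mul0r.
Qed.

End Concatenation.

(** * Cancellation of a sequence against its inverse *)

Section Inverse.
Context {R : realType}.
Local Notation pi := (@trigo.pi R).
Variable g : nat -> R -> R[i].
Hypothesis tg : forall i, tame (g i).

(* The driver of [g] followed by its inverse is symmetric about [pi], so its
   iterated integrals agree at [0] and [2 * pi]. *)
Lemma iterated_tail_cat_inv w : w != [::] ->
  iterated_tail (fun i => tame_cat (g i) (tame_inv (g i))) w 0 = 0.
Proof.
move=> w0; have p0 := pi_gt0 R; set c := fun i => _.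
have tc i : tame (c i) by apply: tame_tame_cat => //; exact: tame_tame_inv.
have zI : (0 : R) <= 0 <= pi by apply/andP; split; lra.
have pI : (0 : R) <= pi <= pi by apply/andP; split; lra.
have cdev : develops 0 pi (fun i t => - tail (c i) t)
    (fun w t => iterated_tail c w (-1 * t + 2 * pi)).
  apply: (@develops_driver _ _ _ (fun i t => - tail (c i) (-1 * t + 2 * pi))).
    move=> i s t _ _; have ti := tame_tame_inv (tg i).
    (* The reflection exchanges the contributions of the two halves to the driver. *)
    have E r : tail (c i) (-1 * r + 2 * pi) = tail (c i) r.
      rewrite !tail_cat// !tail_inv//.
      have -> : 2 * pi - (2 * (-1 * r + 2 * pi) - 2 * pi) = 2 * r by ring.
      have -> : 2 * pi - (2 * r - 2 * pi) = 2 * (-1 * r + 2 * pi) by ring.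
      by ring.
    by rewrite !E.
  apply: (develops_affine (k := -1) (c := 2 * pi)
    _ (iterated_tail_develops tc 0 (2 * pi))).
  by move=> s /andP[s0 s1]; apply/andP; split; lra.
rewrite (develops_unique pI (iterated_tail_develops tc _ _) cdev)//.
  by rewrite mulr0 add0r iterated_tail_ge2pi// (negPf w0).
by move=> v; congr iterated_tail; ring.
Qed.

End Inverse.

(** * Passage from almost-everywhere classes to pointwise representatives *)

Section Representation.
Context {R : realType}.
Local Notation leb := (@lebesgue_measure R).
Local Notation pi := (@trigo.pi R).
Local Notation RT := (measurableTypeR R).
Local Notation Re := (@complex.Re R).
Local Notation Im := (@complex.Im R).

Definition ae_circle_eq (f g : R -> R[i]) :=
  {ae @circle_measure R, forall t, f t = g t}.

(** The function is set to 0 outside []0, 2 * pi[] and wherever its real or imaginary part exceeds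
    the essential bound [M]; on the circle this changes it only on a null set. *)
Lemma exists_tame (f : bounded_periodic R) : exists2 g, tame g & ae_circle_eq f g.
Proof.
have [M M0 /supnormP fM] := supnorm_fin f.
have [mr mi] := bp_measurable f.
pose B t := (0 < t) && (t < 2 * pi) && ((`|Re (f t)| <= M) && (`|Im (f t)| <= M)).
have mB : measurable_fun [set: R] B.
  apply: measurable_and; apply: measurable_and.
  - exact: measurable_fun_ltr.
  - exact: measurable_fun_ltr.
  - by apply: measurable_fun_ler => //; exact: measurableT_comp.
  - by apply: measurable_fun_ler => //; exact: measurableT_comp.
exists (fun t => if B t then f t else 0).
  have [mgr mgi] : cmeasurable (fun t => if B t then f t else 0).
    by apply: cmeasurable_if => //; split; exact: measurable_cst.
  split; split => //.
  - by exists M => t /=; case: ifP => [/andP[_ /andP[]]//|_]; rewrite normr0.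
  - by move=> t tI; rewrite /= ifF//; apply/negP => /andP[H _]; rewrite H in tI.
  - by exists M => t /=; case: ifP => [/andP[_ /andP[]]//|_]; rewrite normr0.
  - by move=> t tI; rewrite /= ifF//; apply/negP => /andP[H _]; rewrite H in tI.
apply/ae_circleP; move/ae_circleP : fM => fM.
have n2pi : {ae leb, forall t, t != 2 * pi}.
  exists [set 2 * pi]; split => //; first exact: lebesgue_measure_set1.
  by move=> t /= /negP/negPn/eqP.
move: fM n2pi; apply: filterS2 => t fM t2pi tI; rewrite ifT//.
have := fM tI; rewrite lee_fin => {}fM; move: tI.
rewrite /circle_itv/= in_itv/= => /andP[t0 t1].
rewrite /B t0 lt_neqAle t2pi t1/= (le_trans (le_Re_normc _) fM).
exact: le_trans (le_Im_normc _) fM.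
Qed.

Lemma rtail_itv f s : rtame f -> \int[leb]_(u in `[s, 2 * pi]) f u = rtail f s.
Proof.
move=> [_ _ f0].
have -> : `[s, 2 * pi]%classic = `[s, +oo[%classic `&` `]-oo, 2 * pi]%classic.
  apply/seteqP; split=> u; rewrite /= !in_itv/= andbT; first by move=> /andP[].
  by move=> [-> ->].
rewrite (@Rintegral_mkcondr _ _ _ leb); congr (Rintegral _ _ _).
apply/funext => u; rewrite patchE; case: ifPn => //.
rewrite notin_setE /= in_itv/= => /negP; rewrite -ltNge => pu.
by rewrite f0// negb_and -!leNgt (ltW pu) orbT.
Qed.

Lemma Rintegral_ae_circle (f g : R -> R) s : measurable_fun [set: R] f -> rtame g ->
  {ae @circle_measure R, forall t, f t = g t} -> 0 <= s ->
  \int[leb]_(u in `[s, 2 * pi]) f u = rtail g s.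
Proof.
move=> mf tg /ae_circleP fg s0; rewrite -rtail_itv//; congr fine.
have [mg _ _] := tg.
apply: ae_eq_integral => //; try by apply/measurable_EFinP; exact: measurable_funTS.
(* When [s = 0] the domain contains 0, which lies outside []0, 2 * pi]]. *)
have n0 : {ae leb, forall t, t != 0}.
  exists [set 0]; split => //; first exact: lebesgue_measure_set1.
  by move=> t /= /negP/negPn/eqP.
move: fg n0; apply: filterS2 => t fg t0 /=; rewrite in_itv/= => /andP[st t1].
by rewrite fg// /circle_itv/= in_itv/= lt_neqAle eq_sym t0 (le_trans s0 st).
Qed.

Lemma Cintegral_ae_circle (f g : R -> R[i]) s : cmeasurable f -> tame g ->
  ae_circle_eq f g -> 0 <= s -> Cintegral `[s, 2 * pi] f = tail g s.
Proof.
move=> [mr mi] [tr ti] fg s0; apply: complex_ext; apply: Rintegral_ae_circle => //.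
- by apply: filterS fg => t /= ->.
- by apply: filterS fg => t /= ->.
Qed.

Lemma cmeasurableM (f g : R -> R[i]) : cmeasurable f -> cmeasurable g ->
  cmeasurable (fun t => f t * g t).
Proof.
move=> [fr fi] [gr gi]; split.
- have -> : (fun t => Re (f t * g t)) =
      (fun t => Re (f t) * Re (g t) - Im (f t) * Im (g t)).
    by apply/funext => t; rewrite complexReM.
  by apply: measurable_funB; exact: measurable_funM.
- have -> : (fun t => Im (f t * g t)) =
      (fun t => Re (f t) * Im (g t) + Im (f t) * Re (g t)).
    by apply/funext => t; rewrite complexImM.
  by apply: measurable_funD; exact: measurable_funM.
Qed.

Definition represents (g : nat -> R -> R[i]) (a : Xspace R) :=
  forall i, tame (g i) /\ ae_circle_eq (a i) (g i).

Lemma exists_represents a : exists g, represents g a.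
Proof.
have /choice[g ga] : forall i, exists g, tame g /\ ae_circle_eq (a i) g.
  by move=> i; have [g tg ag] := exists_tame (repr (a i)); exists g.
by exists g.
Qed.

Lemma represents_cat g h a b : represents g a -> represents h b ->
  represents (fun i => tame_cat (g i) (h i)) (catX a b).
Proof.
move=> ga hb i; have [tg ag] := ga i; have [th bh] := hb i.
split; first exact: tame_tame_cat.
have := cat_fun_ae ag bh; have := Linf_reprE (bp_cat (repr (a i)) (repr (b i))).
move=> /ae_circleP H1 /ae_circleP H2; apply/ae_circleP.
move: H1 H2; apply: filterS2 => t E1 E2 tI; rewrite (etrans (E1 tI) (E2 tI)).
rewrite /cat_fun /periodize to_circle_itv_id// /tame_cat addr0.
case: (leP t pi) => tp.
  rewrite (tame_out th) ?mulr0 ?addr0//.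
  by rewrite negb_and -leNgt subr_le0 ler_pM2l// tp.
rewrite (tame_out tg) ?mulr0 ?add0r//.
by rewrite negb_and -!leNgt orbC ler_pM2l// ltW.
Qed.

Lemma represents_inv g a : represents g a ->
  represents (fun i => tame_inv (g i)) (invX a).
Proof.
move=> ga i; have [tg ag] := ga i.
split; first exact: tame_tame_inv.
have := inv_fun_ae ag; have := Linf_reprE (bp_inv (repr (a i))).
move=> /ae_circleP H1 /ae_circleP H2; apply/ae_circleP.
move: H1 H2; apply: filterS2 => t E1 E2 tI; rewrite (etrans (E1 tI) (E2 tI)).
by rewrite /inv_fun /periodize to_circle_itv_id.
Qed.

(** The inner integrals are replaced pointwise by induction, valid since [u >= s >= 0], and then
    [a i] is replaced by [g i] almost everywhere. *)
Lemma represents_iterated_integral g a : represents g a ->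
  forall w s, 0 <= s -> iterated_integral_from a w s = iterated_tail g w s.
Proof.
move=> ga; have tg i : tame (g i) by case: (ga i).
elim=> [//|i w IHw] s s0 /=; have [_ ag] := ga i.
have [cg _] := iterated_tail_bounded_measurable tg w.
rewrite -(@Cintegral_ae_circle (fun u => iterated_tail g w u * a i u))//.
- congr Complex; apply: eq_Rintegral => u; rewrite inE/= in_itv/= => /andP[su _];
    by rewrite IHw// (le_trans s0).
- by apply: cmeasurableM => //; exact: bp_measurable.
- exact: iterated_tail_tame.
- by apply: filterS ag => t ->.
Qed.

(** With [B'] the series of the inverse of [b], Chen's identity turns [sim a b] into [A B' = 1],
    while [B B' = 1] always holds; cancelling [B'] gives [A = B]. *)
Lemma simP (a b : Xspace R) :
  sim a b <-> forall w, iterated_integral a w = iterated_integral b w.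
Proof.
have [g ga] := exists_represents a; have [h hb] := exists_represents b.
have tg i : tame (g i) by case: (ga i).
have th i : tame (h i) by case: (hb i).
have ti i : tame (tame_inv (h i)) := tame_tame_inv (th i).
pose A w := iterated_tail g w 0; pose B w := iterated_tail h w 0.
pose B' w := iterated_tail (fun i => tame_inv (h i)) w 0.
have aE w : iterated_integral a w = A w.
  exact: represents_iterated_integral.
have bE w : iterated_integral b w = B w.
  exact: represents_iterated_integral.
have abE w : iterated_integral (catX a (invX b)) w = word_conv A B' w.
  rewrite -iterated_tail_cat//; apply: represents_iterated_integral => //.
  by apply: represents_cat => //; exact: represents_inv.
have BB' w : w != [::] -> word_conv B B' w = 0.
  by move=> w0; rewrite -iterated_tail_cat// iterated_tail_cat_inv.
split=> [ab w|ab w w0].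
  rewrite aE bE; apply: (@word_conv_injl _ _ _ B') => // v.
  (* [universal_centers] only concerns nonempty words; at the empty word both products have the same
     constant term. *)
  have [->|v0] := eqVneq v [::]; first by rewrite /word_conv !big_ord1.
  by rewrite -abE ab// BB'.
rewrite abE -(BB' w w0); congr word_conv; apply/funext => v.
by rewrite -aE -bE.
Qed.

End Representation.

Theorem proposition3p1 (R : realType) :
  [/\ forall a : Xspace R, sim a a,
      forall a b : Xspace R, sim a b -> sim b a,
      forall a b c : Xspace R, sim a b -> sim b c -> sim a c &
      partition [set sim_class a | a in [set: Xspace R]] id [set: Xspace R] ].
Proof.
have refl (a : Xspace R) : sim a a by apply/simP.
have sym (a b : Xspace R) : sim a b -> sim b a.
  by move=> /simP ab; apply/simP => w; rewrite ab.
have trans (a b c : Xspace R) : sim a b -> sim b c -> sim a c.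
  by move=> /simP ab /simP bc; apply/simP => w; rewrite ab.
split => //; split.
- by apply/seteqP; split => // a _; exists (sim_class a); [exists a|exact: refl].
(* Classes sharing an element [c] coincide, which gives disjointness of distinct ones. *)
- move=> _ _ [a _ <-] [b _ <-] [c [ac bc]].
  apply/seteqP; split=> d.
    by move=> ad; apply: trans bc (trans _ _ _ (sym _ _ ac) ad).
  by move=> bd; apply: trans ac (trans _ _ _ (sym _ _ bc) bd).
- by move=> _ [a _ <-]; exists a; exact: refl.
Qed.
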